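(* Let $(\mathbb{N}_4,\leq)$ be the poset on $\{0,1,2,3,4\}$ with strict order given by $a<b\iff b-a\geq 2$. Then $(\mathbb{N}_4,\leq)$ is a monoid poset which is not a full semigroup poset.
   Context: For a semigroup $T$ and a subsemigroup $S<T$ ($S=T$ allowed), define $t\leq_S t' :\iff \exists s\in S:\ ts=t'$ on $T$; when this is a partial order, $P(T,S)$ denotes $(T,\leq_S)$. A poset is a monoid poset if it is isomorphic to $P(N,M)$ for some monoid $N$ and submonoid $M<N$ (same neutral element); it is a full semigroup poset if it is isomorphic to $P(S,S)$ for some semigroup $S$. *)

(* Defs.v *)
From Corelib Require Relation_Definitions.
From HB Require Import structures.
From mathcomp Require Import all_boot all_order.

Set Implicit Arguments.
Unset Strict Implicit.
Unset Printing Implicit Defensive.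

Definition leS (T : semigroupType) (S : {pred T}) (t t' : T) : Prop :=
  exists2 s, s \in S & (t * s)%g = t'.

(* The poset X is isomorphic to P(T,S), which is only defined when leS S is a
   partial order. *)
Definition iso_P d (X : porderType d) (T : semigroupType) (S : {pred T}) : Prop :=
  Relation_Definitions.order T (leS S) /\
  exists2 f : X -> T, bijective f &
    forall x y : X, (x <= y)%O <-> leS S (f x) (f y).

Definition monoid_poset d (X : porderType d) : Prop :=
  exists (N : monoidType) (M : {pred N}), monoid_closed M /\ iso_P X M.

Definition full_semigroup_poset d (X : porderType d) : Prop :=
  exists S : semigroupType, iso_P X (T := S) predT.

(* An alias, because 'I_5 canonically carries the usual linear order. *)
Definition N4 : Type := 'I_5.
HB.instance Definition _ := Finite.on N4.

(* Truncated subtraction is harmless here: b - a is 0 when b <= a. *)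
Definition N4_lt : rel N4 := fun a b : 'I_5 => 2 <= b - a.

Fact N4_lt_irr : irreflexive N4_lt.
Proof. by move=> a; rewrite /N4_lt subnn. Qed.

Fact N4_lt_trans : transitive N4_lt.
Proof.
move=> b a c; rewrite /N4_lt !ltn_subRL !addn1 => ab bc.
by apply: ltn_trans bc; apply: leq_trans ab (leqnSn _).
Qed.

Fact N4_display : Order.disp_t. Proof. exact: Order.Disp tt tt. Qed.

HB.instance Definition _ :=
  Order.Lt_isPOrder.Build N4_display N4 N4_lt_irr N4_lt_trans.

(* Main.v *)
Require Import Defs.
From HB Require Import structures.
From mathcomp Require Import all_boot all_order.

Set Implicit Arguments.
Unset Strict Implicit.
Unset Printing Implicit Defensive.

Import Order.Theory.

(** That the poset is a monoid poset is witnessed by an explicit monoid on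
    {0,1,2,3,4} with neutral element 0, in which 3 and 4 are left zeros, and by
    the submonoid {0,2,3,4}.  In this monoid [a * b = b] whenever [a < b], so
    everything above [a] is reached from [a], and conversely [a <= a * s] for
    every [s] other than 1 (lemma [leS_N4mon]).

    It is not a full semigroup poset because in P(S,S) the principal up-set of
    [t] is the right ideal [t S] (as [t] lies in [t S]), so left multiplication
    by [x] maps the up-set of [a] onto the up-set of [x * a] (lemma [up_mul]);
    in particular it cannot increase the cardinality of up-sets.  Now 0 has an
    up-set with four elements, and all other up-sets have at most three.  From
    [0 <= 0] there is [s] with [0 * s = 0], and counting forces [s = 0]; hence 0
    is idempotent and fixes every element of its up-set {0,2,3,4} from the left.
    Then [0 * 1] lies above 0 and below both [0 * 3 = 3] and [0 * 4 = 4], which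
    leaves only [0 * 1 = 0].  So the up-set of 1, which has three elements, is
    mapped onto that of 0, which has four: a contradiction. *)

(** The element [k] of the poset, for a literal [k] less than 5. *)
Local Notation elt k := (@Ordinal 5 k isT : N4).

Lemma N4_leE (x y : N4) : (x <= y)%O = (x == y) || N4_lt x y.
Proof. exact: le_eqVlt. Qed.

(** The multiplication: 0 is neutral, 3 and 4 are left zeros, [2 * b = 4] and
    [1 * b] is [b] or 4 according to the parity of [b], for nonzero [b]. *)
Definition mul_nat (a b : nat) : nat :=
  match a, b with
  | 0, _ => b
  | _, 0 => a
  | 1, _ => if odd b then b else 4
  | 2, _ => 4
  | _, _ => a
  end.

Lemma mul_nat_lt5 (a b : 'I_5) : mul_nat a b < 5.
Proof.
by case: a b => [[|[|[|[|[|//]]]]] ?] [[|[|[|[|[|//]]]]] ?].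
Qed.

(** The monoid, on a copy of ['I_5] that does not inherit other structures. *)
Definition N4mon : Type := 'I_5.
HB.instance Definition _ := Choice.on N4mon.

Definition N4mon_mul (a b : N4mon) : N4mon := Ordinal (mul_nat_lt5 a b).

Lemma N4mon_mulA : associative N4mon_mul.
Proof.
move=> a b c; apply: val_inj.
by case: a b c => [[|[|[|[|[|//]]]]] ?] [[|[|[|[|[|//]]]]] ?]
  [[|[|[|[|[|//]]]]] ?].
Qed.

Lemma N4mon_mul0l : left_id (elt 0) N4mon_mul.
Proof. by move=> a; apply: val_inj. Qed.

Lemma N4mon_mul0r : right_id (elt 0) N4mon_mul.
Proof. by move=> a; apply: val_inj; case: a => [[|[|[|]]] ?]. Qed.

HB.instance Definition _ :=
  isMonoid.Build N4mon N4mon_mulA N4mon_mul0l N4mon_mul0r.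

(** The submonoid {0,2,3,4}. *)
Definition N4sub : {pred N4mon} := [pred a : 'I_5 | val a != 1].

Lemma N4sub_closed : monoid_closed N4sub.
Proof.
split=> // a b.
by case: a b => [[|[|[|[|[|//]]]]] ?] [[|[|[|[|[|//]]]]] ?].
Qed.

Lemma leS_N4mon (x y : N4) : (x <= y)%O <-> leS N4sub (x : N4mon) y.
Proof.
rewrite N4_leE; split=> [/orP[/eqP <-|lt_xy]|[s sM <-]].
- by exists 1%g; [case: N4sub_closed | exact: mulg1].
- exists y; first by case: x y lt_xy => [[|x] ?] [[|[|y]] ?].
  apply: val_inj; move: lt_xy.
  by case: x y => [[|[|[|[|[|//]]]]] ?] [[|[|[|[|[|//]]]]] ?].
- move: sM.
  by case: x s => [[|[|[|[|[|//]]]]] ?] [[|[|[|[|[|//]]]]] ?].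
Qed.

Lemma monoid_poset_N4 : monoid_poset N4.
Proof.
exists N4mon, N4sub; split; first exact: N4sub_closed.
split; last by exists id; [exists id | exact: leS_N4mon].
split=> [x|x y z|x y].
- exact/leS_N4mon.
- by move=> /leS_N4mon xy /leS_N4mon yz; apply/leS_N4mon/(le_trans xy yz).
- move=> /leS_N4mon xy /leS_N4mon yx.
  by apply: (@le_anti _ N4); rewrite xy yx.
Qed.

Section UpSets.
Context {d : Order.disp_t} {T : finPOrderType d} (mul : T -> T -> T).
Hypothesis mulA : associative mul.
Hypothesis le_mul : forall x y : T, (x <= y)%O <-> exists s, mul x s = y.

(** The principal up-set of [x]. *)
Definition up (x : T) : {set T} := [set y | (x <= y)%O].

Lemma up_mul x a : up (mul x a) = mul x @: up a.
Proof.
apply/setP=> y; rewrite inE; apply/idP/imsetP.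
  move=> /le_mul[s <-]; exists (mul a s); last by rewrite mulA.
  by rewrite inE; apply/le_mul; exists s.
case=> z; rewrite inE => /le_mul[s <-] ->.
by apply/le_mul; exists s; rewrite mulA.
Qed.

Lemma leq_card_up_mul x a : #|up (mul x a)| <= #|up a|.
Proof. by rewrite up_mul leq_imset_card. Qed.

Lemma idem_mul_up e y : mul e e = e -> (e <= y)%O -> mul e y = y.
Proof. by move=> ee /le_mul[s <-]; rewrite mulA ee. Qed.

End UpSets.

Lemma card_up0 : #|up (elt 0)| = 4.
Proof.
rewrite (_ : up _ = ~: [set elt 1]) ?cardsC1 ?card_ord //.
by apply/setP=> y; rewrite !inE N4_leE; case: y => [[|[|[|]]] ?].
Qed.

Lemma card_up_neq0 (x : N4) : x != elt 0 -> #|up x| <= 3.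
Proof.
move=> x0; apply: leq_trans (card_size [:: x; elt 3; elt 4]).
apply/subset_leq_card/subsetP=> y; rewrite !inE N4_leE; move: x0.
by case: x y => [[|[|[|[|[|//]]]]] ?] [[|[|[|[|[|//]]]]] ?].
Qed.

Lemma N4_between (x : N4) :
  (elt 0 <= x)%O -> (x <= elt 3)%O -> (x <= elt 4)%O -> x = elt 0.
Proof.
rewrite !N4_leE => x0 x3 x4; apply: val_inj; move: x0 x3 x4.
by case: x => [[|[|[|[|[|//]]]]] ?].
Qed.

Lemma no_full_mul_N4 (mul : N4 -> N4 -> N4) :
  associative mul ->
  ~ (forall x y : N4, (x <= y)%O <-> exists s, mul x s = y).
Proof.
move=> mulA le_mul; pose card_le := leq_card_up_mul mulA le_mul.
have mul00 : mul (elt 0) (elt 0) = elt 0.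
  have [s s0] := (le_mul (elt 0) (elt 0)).1 (lexx _).
  suff s_eq0 : s = elt 0 by rewrite s_eq0 in s0.
  apply/eqP/contraT => /card_up_neq0; rewrite leqNgt.
  by have := card_le (elt 0) s; rewrite s0 card_up0 => ->.
have fix0 y : (elt 0 <= y)%O -> mul (elt 0) y = y.
  exact: idem_mul_up mulA le_mul _ _ mul00.
have mul01_le y : (elt 0 <= y)%O -> (elt 1 <= y)%O ->
    (mul (elt 0) (elt 1) <= y)%O.
  move=> /fix0 {2}<- /le_mul[s <-].
  by apply/le_mul; exists s; rewrite mulA.
have mul01 : mul (elt 0) (elt 1) = elt 0.
  apply: N4_between; first by apply/le_mul; exists (elt 1).
    by apply: mul01_le; rewrite N4_leE.
  by apply: mul01_le; rewrite N4_leE.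
have := card_le (elt 0) (elt 1); rewrite mul01 card_up0.
by rewrite ltnNge card_up_neq0.
Qed.

(** The semigroup operation is transported to the poset along the
    isomorphism. *)
Lemma not_full_semigroup_poset_N4 : ~ full_semigroup_poset N4.
Proof.
case=> S [_ [f [g fK gK] le_f]].
apply: (@no_full_mul_N4 (fun x y => g (f x * f y)%g)).
  by move=> x y z; rewrite !gK mulgA.
move=> x y; split=> [/le_f[s _ xs]|[s xs]].
  by exists (g s); rewrite gK xs fK.
by apply/le_f; exists (f s) => //; rewrite -xs gK.
Qed.

Theorem corollary3p3 : monoid_poset N4 /\ ~ full_semigroup_poset N4.
Proof. exact: conj monoid_poset_N4 not_full_semigroup_poset_N4. Qed.
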